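(* Let $d,r$ be positive integers with $r\mid d$ and $r<d$, and let $\{P_i\}$ be a finite set of rank-$r$ orthogonal projectors on $\mathbb{C}^d$. Then there is a unit vector $|\phi\rangle\in\mathbb{C}^d$ such that, under the valuation $g_\phi$ of projectors inherited from the annulus valuation $f_\phi$ centred on $|\phi\rangle$, at most $$\bigl(I_{1/2}(r,d-r)-I_{r/d}(r,d-r)\bigr)\,\bigl|\{P_i\}\bigr|$$ of the projectors $P_i$ are given a contextual valuation, i.e. satisfy $g_\phi(P_i)=C$. Here $I_x(\alpha,\beta)$ is the regularised incomplete beta function.
   Context: Regularised incomplete beta function: $I_x(\alpha,\beta)=\dfrac{\int_0^x t^{\alpha-1}(1-t)^{\beta-1}\,dt}{\int_0^1 t^{\alpha-1}(1-t)^{\beta-1}\,dt}$ for $\alpha,\beta>0$, $x\in[0,1]$. Annulus valuation: for a unit vector $|\phi\rangle\in\mathbb{C}^d$, the annulus valuation centred on $|\phi\rangle$ is the map $f_\phi$ from unit vectors of $\mathbb{C}^d$ to the three labels $\{0,C,1\}$ given by $f_\phi(|\psi\rangle)=1$ if $|\langle\psi|\phi\rangle|^2>\tfrac12$; $f_\phi(|\psi\rangle)=C$ if $\tfrac1d\le|\langle\psi|\phi\rangle|^2\le\tfrac12$; $f_\phi(|\psi\rangle)=0$ if $|\langle\psi|\phi\rangle|^2<\tfrac1d$. The label $C$ means ''contextual''; the labels $0$ and $1$ are noncontextual valuations. Inherited valuation: for an orthogonal projector $P$ on $\mathbb{C}^d$ of rank $r\ge1$, consider decompositions $P=\sum_{i=1}^r|\psi^{(i)}\rangle\langle\psi^{(i)}|$,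 where $\{|\psi^{(i)}\rangle\}$ is an orthonormal basis of the range of $P$. Then - $g_\phi(P)=0$ if there is such a decomposition with $f_\phi(|\psi^{(i)}\rangle)=0$ for all $i$; - otherwise $g_\phi(P)=1$ if there is such a decomposition with $f_\phi(|\psi^{(i)}\rangle)\in\{0,1\}$ for all $i$; - otherwise $g_\phi(P)=C$. *)

(* Defs.v *)
From HB Require Import structures.
From mathcomp Require Import all_boot all_order all_algebra.
From mathcomp Require Import spectral.
From mathcomp Require Import finmap complex.
From mathcomp Require Import all_classical all_reals all_analysis.

Set Implicit Arguments.
Unset Strict Implicit.
Unset Printing Implicit Defensive.

Import Order.TTheory GRing.Theory Num.Theory.

Local Open Scope ring_scope.
Local Open Scope complex_scope.
Local Open Scope sesquilinear_scope.
Local Open Scope classical_set_scope.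

(* [_ `^ _] is the real power [powR].  Where it differs from the usual
   t^(alpha-1) (1-t)^(beta-1), namely at the end points 0 and 1 when the exponent
   there is negative (it is then 0), the integrals are not affected. *)
Definition incomplete_beta (R : realType) (x alpha beta : R) : R :=
  \int[lebesgue_measure]_(t in `[0, x])
    (t `^ (alpha - 1) * (1 - t) `^ (beta - 1)).

Definition reg_incomplete_beta (R : realType) (x alpha beta : R) : R :=
  incomplete_beta x alpha beta / incomplete_beta 1 alpha beta.

(* Vectors of C^d are columns; the product is antilinear in its first argument. *)
Definition braket (R : realType) (d : nat) (psi phi : 'cV[R[i]]_d) : R[i] :=
  (psi ^t* *m phi) 0 0.

Definition unit_vector (R : realType) (d : nat) (psi : 'cV[R[i]]_d) : Prop :=
  braket psi psi = 1.

Definition orthogonal_projector (R : realType) (d : nat) (P : 'M[R[i]]_d) : Prop :=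
  P *m P = P /\ P ^t* = P.

Inductive label : Set := Label0 | LabelC | Label1.

(* The order on R[i] compares only numbers with the same imaginary part; the
   squared modulus, 1/2 and 1/d are all real, so these are comparisons of reals. *)
Definition annulus_valuation (R : realType) (d : nat) (phi psi : 'cV[R[i]]_d) :
    label :=
  if 2^-1 < `|braket psi phi| ^+ 2 then Label1
  else if d%:R^-1 <= `|braket psi phi| ^+ 2 then LabelC
  else Label0.

Definition orthonormal_family (R : realType) (d n : nat)
    (psi : 'I_n -> 'cV[R[i]]_d) : Prop :=
  forall i j, braket (psi i) (psi j) = (i == j)%:R.

(* The row space of P^T is the transpose of the range of P, so the second clause
   says that the psi i span the range of P. *)
Definition projector_decomposition (R : realType) (d n : nat)
    (P : 'M[R[i]]_d) (psi : 'I_n -> 'cV[R[i]]_d) : Prop :=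
  [/\ orthonormal_family psi,
      (\matrix_(i < n) (psi i)^T == P^T)%MS
    & P = \sum_(i < n) psi i *m (psi i) ^t*].

Definition inherited_valuation (R : realType) (d : nat) (phi : 'cV[R[i]]_d)
    (P : 'M[R[i]]_d) : label :=
  if pselect (exists psi : 'I_(\rank P) -> 'cV[R[i]]_d,
      projector_decomposition P psi /\
      forall i, annulus_valuation phi (psi i) = Label0)
  then Label0
  else if pselect (exists psi : 'I_(\rank P) -> 'cV[R[i]]_d,
      projector_decomposition P psi /\
      forall i, annulus_valuation phi (psi i) = Label0 \/
                annulus_valuation phi (psi i) = Label1)
  then Label1
  else LabelC.

(* Main.v *)
(* If [x = <phi|P|phi>] is below [r/d], some orthonormal basis of the range of [P]
   has all its overlaps with [phi] equal to [x/r < 1/d]; if [x > 1/2], the basis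
   can start with the direction of [P phi] and the other overlaps vanish.  So only
   [r/d <= x <= 1/2] can be contextual.  For [phi] uniform on the sphere, [x] has
   the Beta(r, d - r) law, and averaging the number of contextual projectors gives
   the bound.

   No measure on the sphere is needed.  The number of contextual projectors is an
   integer, so the indicator of [[r/d, 1/2]] may be replaced by a polynomial
   majorant [h], and the average of a polynomial by a finite Gaussian quadrature on
   [R^(2d)] that is exact in the relevant degrees.  The identity [E (x f) = E f'],
   applied to [q = z^* P z] and [n = |z|^2], gives
   [E (q^k n^(K-k)) = E (n^K) * \prod_(i < k) (r + i) / (d + i)], whose factors are
   the moments of Beta(r, d - r). *)

Require Import Defs.
From HB Require Import structures.
From mathcomp Require Import all_boot all_order all_algebra.
From mathcomp Require Import spectral ring lra zify.
From mathcomp Require Import finmap complex polyrcf.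
From mathcomp Require Import all_classical all_reals all_analysis.

Set Implicit Arguments.
Unset Strict Implicit.
Unset Printing Implicit Defensive.

Import Order.TTheory GRing.Theory Num.Theory.
Import numFieldNormedType.Exports.

Local Open Scope ring_scope.
Local Open Scope complex_scope.
Local Open Scope sesquilinear_scope.


(** * Gauss-Hermite quadrature *)

(** By the spectral theorem a unitary [U] diagonalises [J] over [R[i]]. The nodes are the
    eigenvalues and the weights are the squared moduli of the first column of [U]: this is the
    spectral measure of [J] at the first basis vector. *)
Lemma symmetric_matrix_moments (R : rcfType) (n : nat) (J : 'M[R]_n.+1) :
  J^T = J -> exists w x : 'I_n.+1 -> R,
    (forall s, 0 <= w s) /\ forall k, \sum_s w s * x s ^+ k = (J ^+ k) 0 0.
Proof.
move=> symJ; pose JC := map_mx (real_complex R) J.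
have hJ : JC \is hermsymmx.
  apply/is_hermitianmxP; rewrite expr0 scale1r; apply/matrixP => i j.
  rewrite !mxE -[in LHS]symJ mxE /=; exact/esym/conjc_real.
have [U [V [D [spJ UV VU VE rD]]]] : exists (U V : 'M[R[i]]_n.+1) (D : 'rV[R[i]]_n.+1),
    [/\ JC = V *m diag_mx D *m U, U *m V = 1%:M, V *m U = 1%:M, V = U ^t*
      & D \is a realmx].
  have uU := spectral_unitarymx JC.
  exists (spectralmx JC), (invmx (spectralmx JC)), (spectral_diag JC); split.
  - exact/orthomx_spectralP/hermitian_normalmx.
  - by rewrite mulmxV ?unitarymx_unit.
  - by rewrite mulVmx ?unitarymx_unit.
  - by rewrite invmx_unitary.
  - exact: hermitian_spectral_diag_real.
have xE s : (complex.Re (D 0 s))%:C = D 0 s by apply: RRe_real; exact: (mxOverP rD).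
exists (fun s => complex.Re (U s 0) ^+ 2 + complex.Im (U s 0) ^+ 2),
  (fun s => complex.Re (D 0 s)).
split=> [s|k]; first by rewrite addr_ge0 // sqr_ge0.
have JkE : JC ^+ k = V *m diag_mx (\row_s D 0 s ^+ k) *m U.
  elim: k => [|k IH].
    rewrite expr0 (_ : diag_mx _ = 1%:M) ?mulmx1 ?VU //.
    by apply/matrixP => i j; rewrite !mxE expr0.
  rewrite exprS IH -[JC * _]/(JC *m _) [in LHS]spJ -!mulmxA (mulmxA U V) UV.
  rewrite mul1mx; congr (_ *m _); rewrite mulmxA; congr (_ *m _).
  apply/matrixP => i j; rewrite mul_diag_mx !mxE exprS.
  by rewrite mulrnAr.
apply: (@complexI R).
have -> : ((J ^+ k) 0 0)%:C = (JC ^+ k) 0 0.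
  by rewrite -rmorphXn mxE.
rewrite JkE VE mxE rmorph_sum /=; apply: eq_bigr => s _.
rewrite rmorphM rmorphXn /= xE add_Re2_Im2 mul_mx_diag !mxE sqr_normc.
by rewrite [RHS]mulrC mulrA.
Qed.

(* The truncated harmonic oscillator: [J = A + A^T] for an annihilation matrix
   [A], and [A A^T - A^T A] is the identity up to its last diagonal entry, which
   powers of [J] below the truncation order do not reach from the vacuum. *)
Lemma hermite_quadrature (R : rcfType) (K : nat) :
  exists (m : nat) (w x : 'I_m -> R),
    [/\ forall s, 0 <= w s, \sum_s w s = 1
      & forall k, (k <= K)%N ->
          \sum_s w s * x s ^+ k.+1 = k%:R * \sum_s w s * x s ^+ k.-1].
Proof.
pose A : 'M[R]_K.+2 :=
  \matrix_(i, j) (Num.sqrt (j%:R : R) *+ (i.+1 == j :> nat)).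
pose J : 'M[R]_K.+2 := A + A^T.
have symJ : J^T = J by rewrite /J linearD /= trmxK addrC.
have [w [x [w_ge0 wxE]]] := symmetric_matrix_moments symJ.
exists K.+2, w, x; split=> // [|k le_kK].
  have <- : (J ^+ 0) 0 0 = 1 by rewrite expr0 mxE eqxx.
  by rewrite -wxE; apply: eq_bigr => s _; rewrite mulr1.
rewrite !wxE.
pose L : 'M[R]_K.+2 := delta_mx ord_max ord_max.
(* The diagonal of [A * A^T] is [i + 1], but 0 at the last index [K + 1], while that of [A^T * A] is
   [i]. The last difference is thus [- K.+1], that is, [1 - K.+2]. *)
have commA : A * A^T = A^T * A + (1 - K.+2%:R *: L).
  apply/matrixP => i j; rewrite !mxE.
  have -> : \sum_k A i k * A^T k j =
      i.+1%:R *+ ((i == j) && (i < K.+1)%N).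
    have [ltiK|leKi] := ltnP i K.+1; last first.
      rewrite andbF big1 // => l _; rewrite !mxE (_ : (i.+1 == l :> nat) = false).
        by rewrite mul0r.
      by apply/negbTE; rewrite gtn_eqF // (leq_trans (ltn_ord l)).
    rewrite (bigD1 (Ordinal (ltiK : (i.+1 < K.+2)%N))) //= big1 ?addr0.
      rewrite !mxE /= eqxx eqSS eq_sym val_eqE andbT.
      case: eqP => _; rewrite ?mulr0 // !mulr1n -expr2 sqr_sqrtr //.
    move=> l; rewrite -val_eqE /= eq_sym !mxE => /negbTE->.
    by rewrite mul0r.
  have -> : \sum_k A^T i k * A k j = i%:R *+ (i == j).
    case: (unliftP 0 i) => [i' ->|->].
      rewrite (bigD1 (widen_ord (leqnSn _) i')) //= big1 ?addr0.
        rewrite !mxE /= eqxx -val_eqE /=.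
        case: eqP => [<-|_]; rewrite ?mulr0 // !mulr1n -expr2 sqr_sqrtr //.
      move=> l; rewrite -val_eqE /= !mxE eqSS => /negbTE->.
      by rewrite mul0r.
    by rewrite mul0rn big1 // => l _; rewrite !mxE mul0r.
  have leiK : (i <= K.+1)%N by rewrite -ltnS.
  rewrite -!val_eqE /= ltn_neqAle leiK andbT.
  have [<-|nij] := eqVneq (i : nat) j; last first.
    rewrite /= !mulr0n !add0r.
    case: (i =P K.+1 :> nat) => [iK|_] /=; last by rewrite mulr0 oppr0.
    by move: nij; rewrite iK eq_sym => /negbTE->; rewrite mulr0 oppr0.
  rewrite andbb; case: (i =P K.+1 :> nat) => [->|_] /=; rewrite ?mulr0n ?mulr1n ?mulr1.
    by rewrite addrA natr1 subrr.
  by rewrite mulr0 subr0 natr1.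
have AJ : A * J = J * A + (1 - K.+2%:R *: L).
  by rewrite /J mulrDr mulrDl commA addrA.
(* [J] is tridiagonal, so [J ^+ l] moves the first basis vector by at most [l] places; for [l <= K]
   it does not reach the last index [K + 1]. *)
have J0 l (j : 'I_K.+2) : (l < j)%N -> (J ^+ l) 0 j = 0.
  elim: l j => [|l IH] j lt_lj.
    by rewrite expr0 mxE -val_eqE /= ltn_eqF.
  rewrite exprSr mxE big1 // => i _.
  have [lt_li|le_il] := ltnP l i; first by rewrite IH ?mul0r.
  rewrite [X in _ * X](_ : _ = 0) ?mulr0 // !mxE.
  have /negbTE-> : (i.+1 != j :> nat).
    by rewrite ltn_eqF // (leq_ltn_trans _ lt_lj).
  have /negbTE-> : (j.+1 != i :> nat).
    by rewrite gtn_eqF // ltnS (leq_trans le_il) // ltnW // ltnW.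
  by rewrite !mulr0n addr0.
pose e : 'rV[R]_K.+2 := delta_mx 0 0.
have eE (M : 'M[R]_K.+2) : M 0 0 = (e *m M) 0 0 by rewrite -rowE mxE.
have eJL l : (l <= K)%N -> e *m (J ^+ l * L) = 0.
  move=> le_lK; rewrite -rowE; apply/rowP => j; rewrite !mxE big1 // => i _.
  rewrite mxE; case: eqP => [->|_]; last by rewrite mulr0.
  by rewrite J0 ?mul0r.
(* Moving [A] across each factor [J] leaves one commutator. On the first row it acts as the
   identity, since the corner term [L] vanishes there by [eJL]. *)
have eAJ l : (l <= K.+1)%N ->
    e *m (A * J ^+ l) = e *m (J ^+ l * A + l%:R *: J ^+ l.-1).
  elim: l => [|l IH] le_lK; first by rewrite expr0 mulr1 mul1r scale0r addr0.
  rewrite exprSr mulrA -[A * _ * J]/(A * J ^+ l *m J) mulmxA IH 1?ltnW // -mulmxA mulmxE.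
  rewrite mulrDl -mulrA AJ mulrDr mulrA -exprSr mulrBr mulr1 -scalerAr.
  rewrite -addrA mulmxDr [in RHS]mulmxDr; congr (_ + _).
  rewrite !(mulmxDr, mulmxN) -scalemxAr eJL // scaler0 oppr0 addr0.
  rewrite -mulmxDr; congr (_ *m _).
  rewrite -scalerAl; case: l {IH le_lK} => [|l]; first by rewrite !scale0r addr0 scale1r.
  by rewrite -exprSr -[l.+2%:R]natr1 scalerDl scale1r addrC.
(* The first row of [A^T] and the first column of [A] are zero, so only the commutator term
   [k%:R *: J ^+ k.-1] contributes to the corner entry of [J ^+ k.+1]. *)
have ATk : (e *m (A^T * J ^+ k)) 0 0 = 0.
  by rewrite -eE mxE big1 // => i _; rewrite !mxE mul0r.
have JkA : (e *m (J ^+ k * A)) 0 0 = 0.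
  rewrite -eE mxE big1 // => i _; rewrite [A i 0]mxE.
  by rewrite mulr0n mulr0.
rewrite exprS {1}/J mulrDl eE !mulmxDr eAJ 1?leqW // mulmxDr -scalemxAr.
have addE (M N : 'rV[R]_K.+2) : (M + N) 0 0 = M 0 0 + N 0 0 by rewrite mxE.
by rewrite !addE ATk JkA addr0 add0r mxE -eE.
Qed.

(** * Gaussian averages of quadratic forms *)

(** The product quadrature: the expectation of [F] when the [n] coordinates are independent, each
    with mass [w s] at the node [x s]. *)
Definition nodes_avg (R : comRingType) (m n : nat) (w x : 'I_m -> R)
    (F : 'cV[R]_n -> R) : R :=
  \sum_(s : {ffun 'I_n -> 'I_m}) (\prod_j w (s j)) * F (\col_j x (s j)).

Definition set_coord (R : pzRingType) (n : nat) (v : 'cV[R]_n) (j : 'I_n)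
    (t : R) : 'cV[R]_n := v + (t - v j 0) *: delta_mx j 0.

(** [D] plays the part of the partial derivative of [F] in coordinate [j]. Restricting to lines
    parallel to the axis [j] replaces multivariate polynomials by univariate ones, with degree at
    most [K]. *)
Definition coord_poly (R : comNzRingType) (n : nat) (j : 'I_n) (K : nat)
    (F D : 'cV[R]_n -> R) : Prop :=
  forall v, exists2 p : {poly R}, (size p <= K.+1)%N &
    forall t, F (set_coord v j t) = p.[t] /\ D (set_coord v j t) = p^`().[t].

Lemma set_coordE (R : pzRingType) (n : nat) (v : 'cV[R]_n) (j k : 'I_n) (t : R) :
  set_coord v j t k 0 = if k == j then t else v k 0.
Proof.
rewrite !mxE andbT; case: eqP => [->|_]; last by rewrite mulr0 addr0.
by rewrite mulr1 addrCA subrr addr0.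
Qed.

(** Redrawing coordinate [j] independently does not change the law. The proof exchanges the old and
    the fresh value of that coordinate, an involution that preserves the product weight. *)
Lemma sum_resample (R : comPzRingType) (m n : nat) (w : 'I_m -> R) (j : 'I_n)
    (G : {ffun 'I_n -> 'I_m} -> R) :
  \sum_s w s = 1 ->
  \sum_(s : {ffun 'I_n -> 'I_m}) (\prod_k w (s k)) * G s =
  \sum_(s : {ffun 'I_n -> 'I_m}) (\prod_k w (s k)) *
     \sum_t w t * G [ffun k => if k == j then t else s k].
Proof.
move=> w1; pose upd (s : {ffun 'I_n -> 'I_m}) t :=
  [ffun k => if k == j then t else s k].
have WE s t : (\prod_k w (upd s t k)) * w (s j) = (\prod_k w (s k)) * w t.
  rewrite (bigD1 j) //= [in RHS](bigD1 j) //= ffunE eqxx mulrC mulrCA mulrC.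
  congr (_ * _ * _); apply: eq_bigr => k /negbTE kj.
  by rewrite ffunE kj.
pose swap (p : {ffun 'I_n -> 'I_m} * 'I_m) := (upd p.1 p.2, p.1 j).
have swapK : involutive swap.
  move=> [s t]; rewrite /swap /= ffunE eqxx; congr (_, _).
  by apply/ffunP => k; rewrite !ffunE; case: eqP => // ->.
transitivity (\sum_(p : {ffun 'I_n -> 'I_m} * 'I_m) (\prod_k w (p.1 k)) * w p.2 * G p.1).
  rewrite -(pair_bigA _ (fun (s : {ffun 'I_n -> 'I_m}) t =>
    (\prod_k w (s k)) * w t * G s)) /=.
  apply: eq_bigr => s _; rewrite -big_distrl -big_distrr /=.
  by rewrite w1 mulr1.
rewrite (reindex_inj (inv_inj swapK)) /=.
under eq_bigr do rewrite WE.
rewrite -(pair_bigA _ (fun (s : {ffun 'I_n -> 'I_m}) t =>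
  (\prod_k w (s k)) * w t * G (upd s t))) /=.
by apply: eq_bigr => s _; rewrite big_distrr /=; apply: eq_bigr => t _; rewrite mulrA.
Qed.

(** The hypothesis is the identity [E (x f) = E f'] on monomials of degree at most [K]; linearity
    extends it to polynomials. *)
Lemma quadrature_stein (R : comNzRingType) (m K : nat) (w x : 'I_m -> R)
    (p : {poly R}) :
  (forall k, (k <= K)%N ->
    \sum_s w s * x s ^+ k.+1 = k%:R * \sum_s w s * x s ^+ k.-1) ->
  (size p <= K.+1)%N ->
  \sum_s w s * (x s * p.[x s]) = \sum_s w s * p^`().[x s].
Proof.
move=> wx sp.
transitivity (\sum_(i < K.+1) p`_i * \sum_s w s * x s ^+ i.+1).
  under [RHS]eq_bigr do rewrite big_distrr /=.
  rewrite exchange_big /=; apply: eq_bigr => s _.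
  rewrite (horner_coef_wide _ sp) !big_distrr /=; apply: eq_bigr => i _.
  by rewrite exprS; ring.
transitivity (\sum_(i < K.+1) p`_i * (i%:R * \sum_s w s * x s ^+ i.-1)).
  by apply: eq_bigr => i _; rewrite wx // -ltnS.
have dE y : p^`().[y] = \sum_(i < K.+1) p`_i * (i%:R * y ^+ i.-1).
  have sq : (size p^`() <= K)%N.
    case: (eqVneq p 0) => [->|p0]; first by rewrite derivC size_poly0.
    by rewrite -ltnS (leq_trans (lt_size_deriv p0)).
  rewrite (horner_coef_wide _ sq) big_ord_recl /= mul0r mulr0 add0r.
  by apply: eq_bigr => i _; rewrite /bump leq0n add1n coef_deriv mulrA mulr_natr.
under [RHS]eq_bigr do rewrite dE big_distrr /=.
rewrite exchange_big /=; apply: eq_bigr => i _.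
by rewrite !big_distrr /=; apply: eq_bigr => s _; ring.
Qed.

(** Gaussian integration by parts in one coordinate: resampling [j] freezes the other coordinates
    and leaves the univariate identity. *)
Lemma nodes_avg_stein (R : comNzRingType) (m n K : nat) (w x : 'I_m -> R)
    (j : 'I_n) (F D : 'cV[R]_n -> R) :
  \sum_s w s = 1 ->
  (forall k, (k <= K)%N ->
    \sum_s w s * x s ^+ k.+1 = k%:R * \sum_s w s * x s ^+ k.-1) ->
  coord_poly j K F D ->
  nodes_avg w x (fun v => v j 0 * F v) = nodes_avg w x D.
Proof.
move=> w1 wx FD; rewrite /nodes_avg.
rewrite (sum_resample j (fun s => (\col_k x (s k)) j 0 * F (\col_k x (s k)))) //.
rewrite [in RHS](sum_resample j (fun s => D (\col_k x (s k)))) //.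
apply: eq_bigr => s _; congr (_ * _).
have colE t : \col_k x ([ffun k => if k == j then t else s k] k) =
    set_coord (\col_k x (s k)) j (x t).
  apply/colP => k; rewrite set_coordE !mxE ffunE; by case: eqP.
have [p sp pE] := FD (\col_k x (s k)).
transitivity (\sum_t w t * (x t * p.[x t])).
  by apply: eq_bigr => t _; rewrite colE set_coordE eqxx (pE _).1.
rewrite (quadrature_stein wx sp).
by apply: eq_bigr => t _; rewrite colE (pE _).2.
Qed.

Lemma eq_nodes_avg (R : comRingType) (m n : nat) (w x : 'I_m -> R)
    (F G : 'cV[R]_n -> R) : F =1 G -> nodes_avg w x F = nodes_avg w x G.
Proof. by move=> FG; apply: eq_bigr => s _; rewrite FG. Qed.

Lemma nodes_avgD (R : comRingType) (m n : nat) (w x : 'I_m -> R)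
    (F G : 'cV[R]_n -> R) :
  nodes_avg w x (fun v => F v + G v) = nodes_avg w x F + nodes_avg w x G.
Proof. by rewrite -big_split; apply: eq_bigr => s _; rewrite mulrDr. Qed.

Lemma nodes_avgZ (R : comRingType) (m n : nat) (w x : 'I_m -> R) (a : R)
    (F : 'cV[R]_n -> R) :
  nodes_avg w x (fun v => a * F v) = a * nodes_avg w x F.
Proof. by rewrite big_distrr; apply: eq_bigr => s _; rewrite mulrCA. Qed.

Lemma nodes_avg_sum (R : comRingType) (m n : nat) (w x : 'I_m -> R)
    (I : Type) (r : seq I) (F : I -> 'cV[R]_n -> R) :
  nodes_avg w x (fun v => \sum_(i <- r) F i v) =
  \sum_(i <- r) nodes_avg w x (F i).
Proof. by rewrite exchange_big; apply: eq_bigr => s _; rewrite big_distrr. Qed.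

Lemma nodes_avg1 (R : comRingType) (m n : nat) (w x : 'I_m -> R) :
  \sum_s w s = 1 -> nodes_avg w x (fun _ : 'cV[R]_n => 1) = 1.
Proof.
move=> w1; rewrite /nodes_avg; under eq_bigr do rewrite mulr1.
rewrite -(bigA_distr_bigA (fun _ : 'I_n => w)) /=.
by rewrite big1 // => i _; rewrite w1.
Qed.

Lemma le_nodes_avg (R : realDomainType) (m n : nat) (w x : 'I_m -> R)
    (F G : 'cV[R]_n -> R) :
  (forall s, 0 <= w s) -> (forall v, F v <= G v) ->
  nodes_avg w x F <= nodes_avg w x G.
Proof.
by move=> w0 FG; apply: ler_sum => s _; rewrite ler_wpM2l // prodr_ge0.
Qed.

Lemma coord_polyM (R : comNzRingType) (n : nat) (j : 'I_n) (K L : nat)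
    (F D G E : 'cV[R]_n -> R) :
  coord_poly j K F D -> coord_poly j L G E ->
  coord_poly j (K + L) (fun v => F v * G v) (fun v => D v * G v + F v * E v).
Proof.
move=> FD GE v; have [p sp pE] := FD v; have [q sq qE] := GE v.
exists (p * q) => [|t].
  rewrite (leq_trans (size_polyMleq _ _)) // -ltnS.
  by move: sp sq; case: (size p) (size q) => [|a] [|b] //=; lia.
by rewrite (pE t).1 (pE t).2 (qE t).1 (qE t).2 derivM !hornerE.
Qed.

Lemma coord_polyX (R : comNzRingType) (n : nat) (j : 'I_n) (K a : nat)
    (F D : 'cV[R]_n -> R) :
  coord_poly j K F D ->
  coord_poly j (K * a) (fun v => F v ^+ a) (fun v => a%:R * F v ^+ a.-1 * D v).
Proof.
move=> FD v; have [p sp pE] := FD v; exists (p ^+ a) => [|t].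
  rewrite (leq_trans (size_poly_exp_leq _ _)) // ltnS leq_mul2r.
  by apply/orP; right; lia.
rewrite (pE t).1 (pE t).2 deriv_exp hornerMn !hornerE.
by split=> //; rewrite -mulr_natl; ring.
Qed.

(** * Quadratic forms: derivatives along the axes and moments *)

Definition qform (R : pzRingType) (n : nat) (Q : 'M[R]_n) (v : 'cV[R]_n) : R :=
  (v^T *m Q *m v) 0 0.

Lemma qformE (R : comPzRingType) (n : nat) (Q : 'M[R]_n) (v : 'cV[R]_n) :
  qform Q v = \sum_i v i 0 * (Q *m v) i 0.
Proof. by rewrite /qform -mulmxA mxE; apply: eq_bigr => i _; rewrite mxE. Qed.

Lemma mulmx_set_coord (R : comPzRingType) (n : nat) (Q : 'M[R]_n)
    (v : 'cV[R]_n) (i j : 'I_n) (t : R) :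
  (Q *m set_coord v j t) i 0 = (Q *m v) i 0 + (t - v j 0) * Q i j.
Proof. by rewrite mulmxDr -scalemxAr -colE !mxE. Qed.

Lemma qform_set_coord (R : comPzRingType) (n : nat) (Q : 'M[R]_n)
    (v : 'cV[R]_n) (j : 'I_n) (t : R) : Q^T = Q ->
  qform Q (set_coord v j t) =
  qform Q v + 2 * (t - v j 0) * (Q *m v) j 0 + (t - v j 0) ^+ 2 * Q j j.
Proof.
move=> symQ; rewrite qformE.
under eq_bigr do rewrite mulmx_set_coord.
have -> : \sum_i set_coord v j t i 0 * ((Q *m v) i 0 + (t - v j 0) * Q i j) =
   \sum_i (v i 0 * (Q *m v) i 0 + (t - v j 0) * (Q i j * v i 0)
      + (t - v j 0) * ((i == j)%:R * ((Q *m v) i 0 + (t - v j 0) * Q i j))).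
  by apply: eq_bigr => i _; rewrite !mxE andbT; ring.
rewrite !big_split -!big_distrr /= -qformE.
have -> : \sum_i Q i j * v i 0 = (Q *m v) j 0.
  by rewrite mxE; apply: eq_bigr => i _; rewrite -[in LHS]symQ mxE.
rewrite (bigD1 j) //= big1 => [|i /negbTE->]; last by rewrite mul0r.
rewrite eqxx /=; ring.
Qed.

Lemma coord_poly_mulmx (R : comNzRingType) (n : nat) (Q : 'M[R]_n) (i j : 'I_n) :
  coord_poly j 1 (fun v => (Q *m v) i 0) (fun _ => Q i j).
Proof.
move=> v; exists (((Q *m v) i 0 - v j 0 * Q i j)%:P + Q i j *: 'X) => [|t].
  rewrite (leq_trans (size_polyD _ _)) // geq_max.
  rewrite (leq_trans (size_polyC_leq1 _)) //.
  by rewrite (leq_trans (size_scale_leq _ _)) ?size_polyX.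
by rewrite mulmx_set_coord derivD derivC derivZ derivX !hornerE; split; ring.
Qed.

Lemma coord_poly_qform (R : comNzRingType) (n : nat) (Q : 'M[R]_n) (j : 'I_n) :
  Q^T = Q -> coord_poly j 2 (qform Q) (fun v => 2 * (Q *m v) j 0).
Proof.
move=> symQ v; set y := 'X - (v j 0)%:P.
exists ((qform Q v)%:P + (2 * (Q *m v) j 0) *: y + Q j j *: y ^+ 2) => [|t].
  have sy : (size y <= 2)%N by rewrite size_XsubC.
  have sy2 : (size (y ^+ 2) <= 3)%N.
    by rewrite (leq_trans (size_poly_exp_leq _ _)) // size_XsubC.
  rewrite (leq_trans (size_polyD _ _)) // geq_max.
  rewrite (leq_trans (size_scale_leq _ _) sy2) andbT.
  rewrite (leq_trans (size_polyD _ _)) // geq_max.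
  rewrite (leq_trans (size_polyC_leq1 _)) //.
  by rewrite (leq_trans (size_scale_leq _ _)) // ltnW.
rewrite qform_set_coord // mulmx_set_coord /y.
rewrite !(derivD, derivZ, deriv_exp, derivN, derivC, derivX) !hornerE /= expr1.
by split; ring.
Qed.

(* The divergence theorem for the Gaussian weight, with the field [S v]. *)
Lemma nodes_avg_qform_mul (R : comNzRingType) (m n K : nat) (w x : 'I_m -> R)
    (S : 'M[R]_n) (F : 'cV[R]_n -> R) (D : 'I_n -> 'cV[R]_n -> R) :
  \sum_s w s = 1 ->
  (forall k, (k <= K.+1)%N ->
    \sum_s w s * x s ^+ k.+1 = k%:R * \sum_s w s * x s ^+ k.-1) ->
  (forall i, coord_poly i K F (D i)) ->
  nodes_avg w x (fun v => qform S v * F v) =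
  \tr S * nodes_avg w x F +
  nodes_avg w x (fun v => \sum_i (S *m v) i 0 * D i v).
Proof.
move=> w1 wx FD.
transitivity (nodes_avg w x
    (fun v => \sum_i v i 0 * ((S *m v) i 0 * F v))).
  apply: eq_nodes_avg => v; rewrite qformE big_distrl /=.
  by apply: eq_bigr => i _; rewrite mulrA.
rewrite !nodes_avg_sum /mxtrace big_distrl -big_split /=.
apply: eq_bigr => i _.
(* The linear factor raises the degree by one, whence exactness up to [K.+1]; its own derivative
   [S i i] sums to the trace. *)
have P := coord_polyM (@coord_poly_mulmx _ _ S i i) (FD i).
rewrite (nodes_avg_stein w1 wx P) nodes_avgD; congr (_ + _).
exact: nodes_avgZ.
Qed.

(** Two recursions determine the moments. The field [Q *m v] adds one power of [qform Q] with factor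
    [\tr Q + 2 c]; the field [v] adds one power of the squared norm with factor [n + 2 (c + d)]. The
    ratio of the resulting products is the stated one. *)
Lemma nodes_avg_qform_moment (R : numFieldType) (m n K a b : nat)
    (w x : 'I_m -> R) (Q : 'M[R]_n) :
  (0 < n)%N -> (2 * (a + b) <= K)%N ->
  \sum_s w s = 1 ->
  (forall k, (k <= K)%N ->
    \sum_s w s * x s ^+ k.+1 = k%:R * \sum_s w s * x s ^+ k.-1) ->
  Q^T = Q -> Q *m Q = Q ->
  nodes_avg w x (fun v => qform Q v ^+ a * qform 1%:M v ^+ b) =
  \prod_(i < a) ((\tr Q + (2 * i)%:R) / (n + 2 * i)%:R) *
  nodes_avg w x (fun v : 'cV_n => qform 1%:M v ^+ (a + b)) /\
  0 < nodes_avg w x (fun v : 'cV_n => qform 1%:M v ^+ (a + b)).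
Proof.
move=> n0 leK w1 wx symQ idQ.
have FD c d i : coord_poly i (2 * c + 2 * d)
    (fun v => qform Q v ^+ c * qform 1%:M v ^+ d)
    (fun v => c%:R * qform Q v ^+ c.-1 * (2 * (Q *m v) i 0) * qform 1%:M v ^+ d
      + qform Q v ^+ c * (d%:R * qform 1%:M v ^+ d.-1 * (2 * (1%:M *m v) i 0))).
  apply: coord_polyM; apply: coord_polyX; apply: coord_poly_qform => //.
  exact: trmx1.
have QQ v : \sum_i (Q *m v) i 0 * (Q *m v) i 0 = qform Q v.
  have -> : qform Q v = ((Q *m v)^T *m (Q *m v)) 0 0.
    by rewrite trmx_mul symQ mulmxA -(mulmxA v^T) idQ.
  by rewrite mxE; apply: eq_bigr => i _; rewrite [in RHS]mxE.
(* At [c = 0] the exponent [c.-1] is truncated to 0, but the factor [c%:R] vanishes. *)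
have pe (y : R) c : c%:R * y ^+ c.-1 * y = c%:R * y ^+ c.
  by case: c => [|c]; rewrite ?mul0r // -mulrA -exprSr.
have wxS c d : (2 * (c + d).+1 <= K)%N -> forall k, (k <= (2 * c + 2 * d).+1)%N ->
    \sum_s w s * x s ^+ k.+1 = k%:R * \sum_s w s * x s ^+ k.-1.
  by move=> le k lek; apply: wx; rewrite (leq_trans lek) // (leq_trans _ le) //; lia.
(* The recursion closes on powers of [qform Q] because, by [QQ], the squared norm of [Q *m v] is
   [qform Q v] again. *)
have recQ c : (2 * c.+1 <= K)%N ->
    nodes_avg w x (fun v : 'cV_n => qform Q v ^+ c.+1) =
    (\tr Q + (2 * c)%:R) * nodes_avg w x (fun v => qform Q v ^+ c).
  move=> le; have wx' := @wxS c 0%N; rewrite addn0 in wx'.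
  have := nodes_avg_qform_mul Q w1 (wx' le) (FD c 0%N).
  rewrite (eq_nodes_avg w x (G := fun v => qform Q v ^+ c.+1)); last first.
    by move=> v; rewrite expr0 mulr1 -exprS.
  move=> ->; rewrite mulrDl; congr (_ * _ + _).
    by apply: eq_nodes_avg => v; rewrite expr0 mulr1.
  rewrite -nodes_avgZ; apply: eq_nodes_avg => v.
  transitivity (2 * (c%:R * qform Q v ^+ c.-1) * \sum_i (Q *m v) i 0 * (Q *m v) i 0).
    by rewrite big_distrr; apply: eq_bigr => i _ /=; ring.
  by rewrite QQ -mulrA pe natrM mulrA.
(* Euler's identity: along the field [v], a form homogeneous of degree [2 (c + d)] is multiplied by
   its degree. *)
have recN c d : (2 * (c + d).+1 <= K)%N ->
    nodes_avg w x (fun v : 'cV_n => qform Q v ^+ c * qform 1%:M v ^+ d.+1) =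
    (n + 2 * (c + d))%:R *
      nodes_avg w x (fun v => qform Q v ^+ c * qform 1%:M v ^+ d).
  move=> le.
  have := nodes_avg_qform_mul 1%:M w1 (wxS _ _ le) (FD c d).
  rewrite (eq_nodes_avg w x
    (G := fun v => qform Q v ^+ c * qform 1%:M v ^+ d.+1)); last first.
    by move=> v; rewrite mulrCA -exprS.
  move=> ->; rewrite natrD mulrDl mxtrace1; congr (_ + _).
  rewrite -nodes_avgZ; apply: eq_nodes_avg => v.
  transitivity (2 * (c%:R * qform Q v ^+ c.-1) * qform 1%:M v ^+ d *
        (\sum_i v i 0 * (Q *m v) i 0)
      + 2 * (d%:R * qform 1%:M v ^+ d.-1) * qform Q v ^+ c *
        (\sum_i v i 0 * (1%:M *m v) i 0)).
    rewrite !big_distrr -big_split; apply: eq_bigr => i _ /=.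
    by rewrite !mul1mx; ring.
  rewrite -!qformE.
  transitivity (2 * (c%:R * qform Q v ^+ c.-1 * qform Q v) * qform 1%:M v ^+ d
      + 2 * (d%:R * qform 1%:M v ^+ d.-1 * qform 1%:M v) * qform Q v ^+ c).
    by ring.
  by rewrite !pe natrM natrD; ring.
have prodQ c : (2 * c <= K)%N ->
    nodes_avg w x (fun v : 'cV_n => qform Q v ^+ c) =
    \prod_(i < c) (\tr Q + (2 * i)%:R).
  elim: c => [|c IH] le.
    by rewrite big_ord0 -[RHS](@nodes_avg1 _ m n w x w1).
  rewrite (recQ c le) big_ord_recr /= IH; [exact: mulrC | lia].
have prodN c d : (2 * (c + d) <= K)%N ->
    nodes_avg w x (fun v : 'cV_n => qform Q v ^+ c * qform 1%:M v ^+ d) =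
    (\prod_(i < c) (\tr Q + (2 * i)%:R)) * \prod_(i < d) (n + 2 * (c + i))%:R.
  elim: d => [|d IH] le.
    rewrite big_ord0 mulr1 -prodQ; last by rewrite -[c]addn0.
    by apply: eq_nodes_avg => v; rewrite mulr1.
  rewrite recN -?addnS // IH; last by lia.
  by rewrite big_ord_recr /= mulrCA [in RHS]mulrA [RHS]mulrC mulrCA.
have -> : nodes_avg w x (fun v : 'cV_n => qform 1%:M v ^+ (a + b)) =
    \prod_(i < a + b) (n + 2 * i)%:R.
  have := @prodN 0%N (a + b)%N leK; rewrite big_ord0 mul1r => <-.
  by apply: eq_nodes_avg => v; rewrite mul1r.
split; last by apply: prodr_gt0 => i _; rewrite ltr0n; lia.
rewrite prodN // big_split_ord /= mulrA -big_split /=; congr (_ * _).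
apply: eq_bigr => i _; rewrite divfK // pnatr_eq0; lia.
Qed.

(** * Polynomial integrals and beta moments *)

(* The constant coefficient is [p`_0 / 0 = 0]. *)
Definition poly_prim (R : unitRingType) (p : {poly R}) : {poly R} :=
  \poly_(i < (size p).+1) (p`_i.-1 / i%:R).

(** Integration by a formal primitive keeps the beta integrals algebraic; [incomplete_betaE] links
    them with the Lebesgue integral. *)
Definition poly_int (R : unitRingType) (a b : R) (p : {poly R}) : R :=
  (poly_prim p).[b] - (poly_prim p).[a].

Lemma coef_poly_prim (R : unitRingType) (p : {poly R}) (i : nat) :
  (0 < i)%N -> (poly_prim p)`_i = p`_i.-1 / i%:R.
Proof.
case: i => // i _; rewrite coef_poly ltnS; case: ltnP => //= leip.
by rewrite nth_default // mul0r.
Qed.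

Lemma deriv_poly_prim (R : numFieldType) (p : {poly R}) : (poly_prim p)^`() = p.
Proof.
apply/polyP => i; rewrite coef_deriv coef_poly_prim //= -[LHS]mulr_natr.
by rewrite divfK ?pnatr_eq0.
Qed.

Lemma poly_int_deriv (R : numFieldType) (a b : R) (p : {poly R}) :
  poly_int a b p^`() = p.[b] - p.[a].
Proof.
have [c pE] : exists c, p = poly_prim p^`() + c%:P.
  exists (p`_0 - (poly_prim p^`())`_0); apply/polyP => -[|i]; rewrite coefD coefC /=.
    by rewrite addrC subrK.
  by rewrite addr0 coef_poly_prim //= coef_deriv -[p`_ _ *+ _]mulr_natr mulfK ?pnatr_eq0.
rewrite /poly_int; set q := poly_prim _ in pE *.
by rewrite [in RHS]pE !hornerE; ring.
Qed.

Lemma poly_intD (R : numFieldType) (a b : R) (p q : {poly R}) :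
  poly_int a b (p + q) = poly_int a b p + poly_int a b q.
Proof.
rewrite -[in LHS](deriv_poly_prim p) -[in LHS](deriv_poly_prim q) -derivD.
by rewrite poly_int_deriv /poly_int !hornerD; ring.
Qed.

Lemma poly_intZ (R : numFieldType) (a b c : R) (p : {poly R}) :
  poly_int a b (c *: p) = c * poly_int a b p.
Proof.
rewrite -[in LHS](deriv_poly_prim p) -derivZ.
by rewrite poly_int_deriv /poly_int !hornerZ mulrBr.
Qed.

Lemma poly_intB (R : numFieldType) (a b : R) (p q : {poly R}) :
  poly_int a b (p - q) = poly_int a b p - poly_int a b q.
Proof. by rewrite poly_intD -scaleN1r poly_intZ mulN1r. Qed.

Lemma poly_int_sum (R : numFieldType) (a b : R) (n : nat) (F : 'I_n -> {poly R}) :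
  poly_int a b (\sum_i F i) = \sum_i poly_int a b (F i).
Proof.
have p0 : poly_int a b 0 = 0 by rewrite -(scale0r 0) poly_intZ mul0r.
exact: (big_morph _ (@poly_intD _ a b) p0).
Qed.

Lemma poly_int_chasles (R : numFieldType) (a b c : R) (p : {poly R}) :
  poly_int a c p = poly_int a b p + poly_int b c p.
Proof. by rewrite /poly_int; ring. Qed.

Lemma poly_int_ge0 (R : rcfType) (a b : R) (p : {poly R}) :
  a <= b -> (forall x, a <= x <= b -> 0 <= p.[x]) -> 0 <= poly_int a b p.
Proof.
move=> ab p0; rewrite /poly_int subr_ge0.
apply: (@ler_hornerW _ a b) => //; rewrite ?in_itv /= ?lexx ?ab //.
by move=> x; rewrite in_itv /= deriv_poly_prim => /andP[ax xb]; rewrite p0 // !ltW.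
Qed.

Lemma le_poly_int (R : rcfType) (a b : R) (p q : {poly R}) :
  a <= b -> (forall x, a <= x <= b -> p.[x] <= q.[x]) ->
  poly_int a b p <= poly_int a b q.
Proof.
move=> ab pq; rewrite -subr_ge0 -poly_intB poly_int_ge0 // => x axb.
by rewrite !hornerE subr_ge0 pq.
Qed.

(** For positive [r] and [s], the unnormalised Beta(r, s) density. *)
Definition beta_poly (R : nzRingType) (r s : nat) : {poly R} :=
  'X^(r.-1) * (1 - 'X) ^+ s.-1.

(** Integration by parts: [X^r (1 - X)^s] vanishes at 0 and 1, and its derivative is [r] times the
    density for [(r, s)] minus [r + s] times the one for [(r + 1, s)]. *)
Lemma poly_int_beta_succ (R : numFieldType) (r s : nat) :
  (0 < r)%N -> (0 < s)%N ->
  poly_int 0 1 (beta_poly R r.+1 s) =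
  r%:R / (r + s)%:R * poly_int 0 1 (beta_poly R r s).
Proof.
case: r s => // r [] // s _ _.
have rs0 : (r.+1 + s.+1)%:R != 0 :> R by rewrite pnatr_eq0.
apply: (mulfI rs0); rewrite mulrA mulrCA divff // mulr1 -!poly_intZ.
apply/esym/eqP; rewrite -subr_eq0 -poly_intB.
have <- : ('X^(r.+1) * (1 - 'X) ^+ s.+1 : {poly R})^`() =
   r.+1%:R *: beta_poly R r.+1 s.+1 - (r.+1 + s.+1)%:R *: beta_poly R r.+2 s.+1.
  rewrite derivM derivXn deriv_exp derivB derivC derivX sub0r /beta_poly /=.
  rewrite -[_ *+ r.+1]mulr_natr -[_ *+ s.+1]mulr_natr -!mul_polyC !polyC_natr.
  by rewrite natrD !exprS; ring.
by rewrite poly_int_deriv !hornerE subrr !expr0n /= !mul0r mulr0 subrr.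
Qed.

Lemma poly_int_beta_moment (R : numFieldType) (r s k : nat) :
  (0 < r)%N -> (0 < s)%N ->
  poly_int 0 1 ('X^k * beta_poly R r s) =
  (\prod_(i < k) ((r + i)%:R / (r + s + i)%:R)) * poly_int 0 1 (beta_poly R r s).
Proof.
move=> r0 s0; have -> : 'X^k * beta_poly R r s = beta_poly R (r + k) s.
  by rewrite /beta_poly mulrA -exprD; congr ('X^_ * _); lia.
elim: k => [|k IH]; first by rewrite addn0 big_ord0 mul1r.
rewrite addnS poly_int_beta_succ ?addn_gt0 ?r0 // IH big_ord_recr /=.
by rewrite addnAC mulrCA mulrA.
Qed.

(** * Polynomial majorants of interval indicators *)

Lemma horner_bounded (R : realDomainType) (p : {poly R}) :
  exists2 M : R, 0 < M & forall x, 0 <= x <= 1 -> p.[x] <= M.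
Proof.
exists (1 + \sum_(i < size p) `|p`_i|); first by rewrite ltr_pwDl ?sumr_ge0.
move=> x /andP[x0 x1]; rewrite horner_coef.
rewrite (@le_trans _ _ (\sum_(i < size p) `|p`_i|)) ?lerDr //.
apply: ler_sum => i _; rewrite (@le_trans _ _ (`|p`_i| * x ^+ i)) //.
  by rewrite ler_wpM2r ?exprn_ge0 // ler_norm.
by rewrite ler_piMr // exprn_ile1.
Qed.

Lemma one_minus_exp_ge (R : realDomainType) (y : R) (n : nat) :
  0 <= y <= 1 -> 1 - n%:R * y <= (1 - y) ^+ n.
Proof.
move=> /andP[y0 y1]; elim: n => [|n IH]; first by rewrite mul0r subr0 expr0.
rewrite exprS -natr1.
have : (1 - y) * (1 - n%:R * y) <= (1 - y) * (1 - y) ^+ n.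
  by rewrite ler_wpM2l // subr_ge0.
apply: le_trans; have := mulr_ge0 (ler0n R n) (mulr_ge0 y0 y0); nra.
Qed.

(** Bernoulli's inequality bounds [(1 + y)^n] from below, and [(1 - y)^n (1 + y)^n <= 1]. *)
Lemma one_minus_exp_le (R : realFieldType) (y : R) (n : nat) :
  0 <= y <= 1 -> (1 - y) ^+ n <= (1 + n%:R * y)^-1.
Proof.
move=> /andP[y0 y1].
have pos : 0 < 1 + n%:R * y by rewrite ltr_pwDl ?mulr_ge0.
rewrite -[X in _ <= X]mul1r ler_pdivlMr //.
have : 1 + n%:R * y <= (1 + y) ^+ n.
  elim: n {pos} => [|n IH]; first by rewrite mul0r addr0 expr0.
  rewrite exprS -natr1.
  have := mulr_ge0 (ler0n R n) (mulr_ge0 y0 y0); nra.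
move=> /(ler_wpM2l (exprn_ge0 n (_ : 0 <= 1 - y))) h.
apply: (le_trans (h _)); first by rewrite subr_ge0.
rewrite -exprMn exprn_ile1 //; nra.
Qed.

Lemma exists_exp_le (R : realType) (q e : R) :
  0 <= q < 1 -> 0 < e -> exists n, q ^+ n <= e.
Proof.
move=> /andP[q0 q1] e0.
have nq1 : `|q| < 1 by rewrite ger0_norm.
have /cvgrPdist_le/(_ e e0) [n _ /(_ n (leqnn n))] := cvg_expr nq1.
by rewrite sub0r normrN ger0_norm ?exprn_ge0 // => h; exists n.
Qed.

(* [N] is chosen close to [rho ^- n] for some [rho] between [rho1] and [rho2]. *)
Lemma exists_sharp_cutoff (R : realType) (rho1 rho2 e : R) :
  0 <= rho1 < rho2 -> rho2 <= 1 -> 0 < e ->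
  exists n N : nat,
    (forall u, 0 <= u <= rho1 -> 1 - e <= (1 - u ^+ n) ^+ N) /\
    (forall u, rho2 <= u <= 1 -> (1 - u ^+ n) ^+ N <= e).
Proof.
move=> /andP[r10 r12] r21 e0.
pose rho := (rho1 + rho2) / 2.
have rho0 : 0 < rho by rewrite /rho; lra.
have r1 : rho1 < rho by rewrite /rho; lra.
have r2 : rho < rho2 by rewrite /rho; lra.
(* With [q ^+ n <= e / 2], both passages, from [rho1] to [rho] and from [rho] to [rho2], shrink
   [n]-th powers by the factor [e / 2]. *)
pose q := Num.max (rho1 / rho) (rho / rho2).
have q1 : 0 <= q < 1.
  rewrite /q le_max divr_ge0 ?(ltW rho0) //= gt_max.
  by rewrite !ltr_pdivrMr ?mul1r ?r1 //; lra.
have [n qn] := @exists_exp_le _ _ (e / 2) q1 (divr_gt0 e0 (ltr0Sn _ _)).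
have q_exp (y z : R) : 0 <= y -> 0 < z -> y / z <= q -> y ^+ n <= e / 2 * z ^+ n.
  move=> y0 z0 yzq; rewrite -ler_pdivrMr ?exprn_gt0 // -expr_div_n.
  apply: le_trans qn; rewrite lerXn2r // ?nnegrE ?divr_ge0 // ?(ltW z0) //.
  by case/andP: q1.
have en : rho1 ^+ n <= e / 2 * rho ^+ n by rewrite q_exp // /q le_max lexx.
have en2 : rho ^+ n <= e / 2 * rho2 ^+ n.
  by rewrite q_exp ?(ltW rho0) ?(lt_trans rho0) // /q le_max lexx orbT.
have rn0 : 0 < rho ^+ n by rewrite exprn_gt0.
have rn1 : rho ^+ n <= 1 by rewrite exprn_ile1 ?(ltW rho0) // (le_trans (ltW r2)).
pose N := (Num.truncn (rho ^- n)).+1.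
have /andP[N1 N2] : (N%:R - 1 <= rho ^- n) && (rho ^- n < N%:R).
  have : 0 <= rho ^- n by rewrite invr_ge0 ltW.
  by move=> /truncn_itv; rewrite /N -natr1 addrK.
have {}N1 : N%:R * rho ^+ n <= 1 + rho ^+ n.
  by move: N1; rewrite -(ler_pM2r rn0) mulVf ?gt_eqF //; lra.
have {}N2 : 1 <= N%:R * rho ^+ n.
  by move: N2; rewrite -(ltr_pM2r rn0) mulVf ?gt_eqF // => /ltW.
have un01 (u : R) : 0 <= u <= 1 -> 0 <= u ^+ n <= 1.
  by move=> /andP[u0 u1]; rewrite exprn_ge0 // exprn_ile1.
exists n, N; split=> [u /andP[u0 u1]|u /andP[u2 u1]].
  have u01 : 0 <= u <= 1 by rewrite u0; lra.
  apply: le_trans (one_minus_exp_ge N (un01 u u01)).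
  have un : u ^+ n <= rho1 ^+ n by rewrite lerXn2r // nnegrE.
  have : N%:R * u ^+ n <= N%:R * (e / 2 * rho ^+ n).
    by rewrite ler_wpM2l // (le_trans un).
  have : e / 2 * (N%:R * rho ^+ n) <= e / 2 * 2.
    by rewrite ler_wpM2l ?divr_ge0 ?(ltW e0) //; lra.
  lra.
have u0 : 0 <= u by lra.
have u01 : 0 <= u <= 1 by rewrite u0.
apply: le_trans (one_minus_exp_le N (un01 u u01)) _.
have un : rho2 ^+ n <= u ^+ n by rewrite lerXn2r // nnegrE //; lra.
have Nu : 1 <= e * (N%:R * u ^+ n).
  have : N%:R * rho ^+ n <= N%:R * (e / 2 * u ^+ n).
    rewrite ler_wpM2l // (le_trans en2) // ler_wpM2l // divr_ge0 ?(ltW e0) //.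
  lra.
have pos : 0 < 1 + N%:R * u ^+ n.
  by rewrite ltr_pwDl // mulr_ge0 // exprn_ge0.
by rewrite -[X in X <= _]mul1r ler_pdivrMr //; lra.
Qed.

(** A sharp cutoff in the squared distance to the midpoint of [[a, c]] is nearly 1 on the interval
    and nearly 0 outside collars of width [dl]; adding [e1] makes it a majorant of the indicator. *)
Lemma exists_poly_majorant (R : realType) (a c e : R) (b : {poly R}) :
  0 < a -> a <= c -> c < 1 -> 0 < e ->
  (forall x, 0 <= x <= 1 -> 0 <= b.[x]) ->
  exists h : {poly R},
    [/\ forall x, a <= x <= c -> 1 <= h.[x],
        forall x, 0 <= x <= 1 -> 0 <= h.[x]
      & poly_int 0 1 (h * b) <= poly_int a c b + e].
Proof.
move=> a0 ac c1 e0 b0.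
have [M M0 bM] := horner_bounded b.
pose T := poly_int 0 1 b.
have T0 : 0 <= T by rewrite poly_int_ge0.
(* The first bound gives each collar an integral of at most [e / 4]; the other two keep the collars
   inside [[0, 1]]. *)
pose dl := Num.min (e / (4 * M)) (Num.min a (1 - c)).
have dl0 : 0 < dl by rewrite !lt_min divr_gt0 ?mulr_gt0 //= a0 subr_gt0.
have dla : dl <= a by rewrite !ge_min lexx orbT.
have dlc : dl <= 1 - c by rewrite !ge_min lexx !orbT.
have dlM : dl * M <= e / 4.
  have : dl <= e / (4 * M) by rewrite ge_min lexx.
  by rewrite ler_pdivlMr ?mulr_gt0 //; lra.
(* Since [h] is at most [1 + e1] on the interval and its collars and at most [2 * e1] elsewhere,
   [e1] costs at most [2 * e1 * T <= e / 2]. With the two collars the total error is [e]. *)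
pose e1 := e / (4 * (T + 1)).
have e10 : 0 < e1 by rewrite divr_gt0 ?mulr_gt0 //; lra.
have e1T : e1 * T <= e / 4.
  have : e1 * (4 * (T + 1)) = e by rewrite divfK // gt_eqF //; lra.
  lra.
(* The half-width [s] may be 0: in the application [a = c] when [d = 2 r]. *)
pose m0 := (a + c) / 2; pose s := (c - a) / 2.
have s0 : 0 <= s by rewrite /s; lra.
have sd : s + dl <= 1 by rewrite /s; lra.
have [||n [N [hi lo]]] := @exists_sharp_cutoff R (s ^+ 2) ((s + dl) ^+ 2) e1 _ _ e10.
- by rewrite sqr_ge0 ltrXn2r // ?nnegrE; lra.
- by rewrite exprn_ile1 //; lra.
pose f : {poly R} := (1 - (('X - m0%:P) ^+ 2) ^+ n) ^+ N.
have fE x : f.[x] = (1 - ((x - m0) ^+ 2) ^+ n) ^+ N by rewrite /f !hornerE.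
have sq_le (y t : R) : 0 <= t -> - t <= y <= t -> 0 <= y ^+ 2 <= t ^+ 2.
  by move=> t0 /andP[yt1 yt2]; rewrite sqr_ge0 /=; nra.
have u01 x : 0 <= x <= 1 -> 0 <= (x - m0) ^+ 2 <= 1.
  move=> /andP[x0 x1]; have := sq_le (x - m0) 1 ler01; rewrite expr1n; apply.
  by rewrite /m0; apply/andP; split; lra.
have f01 x : 0 <= x <= 1 -> 0 <= f.[x] <= 1.
  move=> x01; have /andP[u0 u1] := u01 x x01.
  have := exprn_ge0 n u0; have := exprn_ile1 n u0 u1 => v1 v0.
  by rewrite fE exprn_ge0 ?exprn_ile1 //; lra.
have flo x : 0 <= x <= 1 -> (x <= a - dl) || (c + dl <= x) -> f.[x] <= e1.
  move=> x01 xout; rewrite fE lo //; have /andP[u0 ->] := u01 x x01; rewrite andbT.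
  by case/orP: xout => xo; rewrite /s /m0; nra.
pose h := f + e1%:P.
have hE x : h.[x] = f.[x] + e1 by rewrite !hornerE.
exists h; split.
- move=> x /andP[ax xc]; rewrite hE fE -lerBlDr hi // sq_le //.
  by rewrite /s /m0; apply/andP; split; lra.
- by move=> x /f01/andP[f0 _]; rewrite hE addr_ge0 // ltW.
have ple A B k : 0 <= A -> A <= B -> B <= 1 ->
    (forall x, A <= x <= B -> h.[x] <= k) ->
    poly_int A B (h * b) <= k * poly_int A B b.
  move=> A0 AB B1 hk; rewrite -poly_intZ le_poly_int // => x /andP[Ax xB].
  rewrite hornerM hornerZ ler_wpM2r ?b0 ?hk ?Ax //.
  by apply/andP; split; lra.
have pM A B : 0 <= A -> A <= B -> B <= 1 -> poly_int A B b <= M * (B - A).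
  move=> A0 AB B1; have <- : poly_int A B M%:P = M * (B - A).
    have -> : M%:P = (M *: 'X)^`() by rewrite derivZ derivX alg_polyC.
    by rewrite poly_int_deriv !hornerE mulrBr.
  rewrite le_poly_int // => x /andP[Ax xB]; rewrite hornerC bM //.
  by apply/andP; split; lra.
have pos A B : 0 <= A -> A <= B -> B <= 1 -> 0 <= poly_int A B b.
  move=> A0 AB B1; rewrite poly_int_ge0 // => x /andP[Ax xB]; rewrite b0 //.
  by apply/andP; split; lra.
have I1 : poly_int 0 (a - dl) (h * b) <= (2 * e1) * poly_int 0 (a - dl) b.
  apply: ple; try lra; move=> x /andP[x0 xa]; rewrite hE.
  have : f.[x] <= e1 by rewrite flo ?xa //; apply/andP; split; lra.
  lra.
have I2 : poly_int (a - dl) (c + dl) (h * b) <= (1 + e1) * poly_int (a - dl) (c + dl) b.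
  apply: ple; try lra; move=> x /andP[x0 xa]; rewrite hE lerD2r.
  by have /andP[] : 0 <= f.[x] <= 1 by apply: f01; apply/andP; split; lra.
have I3 : poly_int (c + dl) 1 (h * b) <= (2 * e1) * poly_int (c + dl) 1 b.
  apply: ple; try lra; move=> x /andP[x0 xa]; rewrite hE.
  have : f.[x] <= e1 by rewrite flo ?x0 ?orbT //; apply/andP; split; lra.
  lra.
rewrite (poly_int_chasles 0 (a - dl)) (poly_int_chasles (a - dl) (c + dl) 1).
have TE : T = poly_int 0 (a - dl) b +
    (poly_int (a - dl) a b + (poly_int a c b + (poly_int c (c + dl) b
       + poly_int (c + dl) 1 b))).
  by rewrite /T /poly_int; ring.
have mE : poly_int (a - dl) (c + dl) b =
    poly_int (a - dl) a b + (poly_int a c b + poly_int c (c + dl) b).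
  by rewrite /poly_int; ring.
have P1 : 0 <= poly_int 0 (a - dl) b by apply: pos; lra.
have P2 : 0 <= poly_int (a - dl) a b by apply: pos; lra.
have P3 : 0 <= poly_int a c b by apply: pos; lra.
have P4 : 0 <= poly_int c (c + dl) b by apply: pos; lra.
have P5 : 0 <= poly_int (c + dl) 1 b by apply: pos; lra.
have B2 : poly_int (a - dl) a b <= e / 4.
  by apply: le_trans dlM; rewrite mulrC; apply: le_trans (pM _ _ _ _ _) _; try lra; nra.
have B4 : poly_int c (c + dl) b <= e / 4.
  by apply: le_trans dlM; rewrite mulrC; apply: le_trans (pM _ _ _ _ _) _; try lra; nra.
rewrite mE in I2.
move: TE I1 I2 I3 e1T P1 P2 P3 P4 P5 B2 B4.
move: (poly_int 0 (a - dl) b) (poly_int (a - dl) a b) (poly_int a c b)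
  (poly_int c (c + dl) b) (poly_int (c + dl) 1 b) (poly_int 0 (a - dl) (h * b))
  (poly_int (a - dl) (c + dl) (h * b)) (poly_int (c + dl) 1 (h * b)).
move=> i1 i2 i3 i4 i5 j1 j2 j3 -> E1 E2 E3 E4 *.
have := ltW e10; nra.
Qed.

(** As [r] and [d - r] are positive integers, both exponents are natural numbers. The integrand is
    then a polynomial on [[0, x]], and the fundamental theorem of calculus applies. *)
Lemma incomplete_betaE (R : realType) (x : R) (r d : nat) :
  0 < x <= 1 -> (0 < r)%N -> (r < d)%N ->
  incomplete_beta x r%:R (d%:R - r%:R) = poly_int 0 x (beta_poly R r (d - r)).
Proof.
move=> /andP[x0 x1] r0 rd; rewrite /incomplete_beta.
set p := beta_poly R r (d - r).
transitivity (\int[lebesgue_measure]_(t in `[0, x]%classic) p.[t]).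
  apply: eq_Rintegral => t; rewrite inE /= in_itv /= => /andP[t0 tx].
  have -> : r%:R - 1 = r.-1%:R :> R by rewrite -[in LHS](prednK r0) -natr1 addrK.
  have -> : d%:R - r%:R - 1 = (d - r).-1%:R :> R.
    have dr0 : (0 < d - r)%N by rewrite subn_gt0.
    by rewrite -natrB ?(ltnW rd) // -[in LHS](prednK dr0) -natr1 addrK.
  by rewrite !powR_mulrn ?subr_ge0 ?(le_trans tx) // /p !hornerE.
rewrite /Rintegral (@continuous_FTC2 _ _ (horner (poly_prim p))) //.
- by apply: continuous_subspaceT; exact: continuous_horner.
- split=> [y _||]; first exact: derivable_horner.
  + exact/cvg_at_right_filter/continuous_horner.
  + exact/cvg_at_left_filter/continuous_horner.
- by move=> y _; rewrite -derivE deriv_poly_prim.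
Qed.

(** * Orthonormal bases with prescribed overlaps *)

(** Basis vectors are handled as rows of [W], hence the transpose of [P]; right multiplication of
    [W] by unitaries on its index side then changes the basis. *)
Lemma projector_decomposition_rows (R : realType) (d n : nat) (P : 'M[R[i]]_d)
    (W : 'M[R[i]]_(n, d)) :
  W *m W ^t* = 1%:M -> W ^t* *m W = P^T ->
  projector_decomposition P (fun i => (row i W)^T).
Proof.
move=> WW WP; split.
- move=> i j; rewrite /braket mxE.
  transitivity ((W *m W ^t*) j i); last by rewrite WW mxE eq_sym.
  by rewrite [in RHS]mxE; apply: eq_bigr => l _; rewrite !mxE mulrC.
- have -> : \matrix_(i < n) ((row i W)^T)^T = W.
    by apply/matrixP => i j; rewrite !mxE.
  apply/andP; split; last by rewrite -WP submxMl.
  by rewrite -[X in (X <= _)%MS]mul1mx -WW -mulmxA WP submxMl.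
- apply: trmx_inj; rewrite -WP; apply/matrixP => a b.
  rewrite [in RHS]mxE summxE mxE; apply: eq_bigr => i _.
  by rewrite [in RHS]mxE big_ord1 !mxE mulrC.
Qed.

Lemma trmxC_mul (C : numClosedFieldType) (m n p : nat) (A : 'M[C]_(m, n))
    (B : 'M[C]_(n, p)) : (A *m B) ^t* = B ^t* *m A ^t*.
Proof. by rewrite trmx_mul map_mxM. Qed.

(** Gram-Schmidt on the row space of [S = P^T] yields [W]. The Hermitian matrices [S] and
    [W ^t* *m W] satisfy [SB] and [BS]; taking the adjoint of [SB] identifies them. *)
Lemma projector_row_basis (R : realType) (d n : nat) (P : 'M[R[i]]_d) :
  orthogonal_projector P -> \rank P = n ->
  exists2 W : 'M[R[i]]_(n, d), W *m W ^t* = 1%:M & W ^t* *m W = P^T.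
Proof.
move=> [PP Ph]; rewrite -mxrank_tr => <-; set S := P^T.
have SS : S *m S = S by rewrite -trmx_mul PP.
have Sh : S ^t* = S.
  by rewrite /S -[in RHS]Ph; apply/matrixP => i j; rewrite !mxE.
pose W := schmidt (row_base S).
have WS : (W :=: S)%MS.
  by apply: eqmx_trans (eqmx_schmidt_free (row_base_free S)) (eq_row_base S).
have WW : W *m W ^t* = 1%:M.
  by apply/unitarymxP/schmidt_unitarymx; exact: rank_leq_col.
exists W => //.
have SB : S *m (W ^t* *m W) = S.
  have /submxP [X XE] : (S <= W)%MS by rewrite WS.
  transitivity (X *m W *m (W ^t* *m W)); first by rewrite -XE.
  by rewrite mulmxA -(mulmxA X) WW mulmx1 -XE.
have BS : W ^t* *m W *m S = W ^t* *m W.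
  have /submxP [X XE] : (W <= S)%MS by rewrite WS.
  by rewrite -mulmxA; congr (_ *m _); rewrite [in LHS]XE -mulmxA SS -XE.
have := congr1 (fun M => M ^t*) SB.
by rewrite !trmxC_mul trmxCK Sh BS.
Qed.

(** Gram-Schmidt on the square matrix whose rows all equal [u] returns a unitary matrix, even for
    [u = 0]; its first row is [u] up to a nonnegative factor. *)
Lemma unitary_row_polar (C : numClosedFieldType) (n : nat) (u : 'rV[C]_n.+1) :
  exists (S : 'M[C]_n.+1) (b : C),
    [/\ S *m S ^t* = 1%:M, 0 <= b & u = b *: row 0 S].
Proof.
pose A : 'M[C]_n.+1 := \matrix_(i, j) u 0 j.
have A0 : row 0 A = u by apply/rowP => j; rewrite !mxE.
have SS : schmidt A *m (schmidt A) ^t* = 1%:M.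
  by apply/unitarymxP/schmidt_unitarymx.
have : (u <= row 0 (schmidt A))%MS.
  rewrite -A0 (submx_trans (row_schmidt_sub A 0)) //.
  apply/sumsmx_subP => k; rewrite leqn0 => /eqP k0.
  by rewrite genmxE (_ : k = 0) //; apply/val_inj.
move=> /sub_rVP [b uE]; exists (schmidt A), b; split=> //.
have := form1_row_schmidt A 0; rewrite A0 uE dotmxE -scalemxAl mxE.
suff -> : (row 0 (schmidt A) *m (row 0 (schmidt A)) ^t*) 0 0 = 1 by rewrite mulr1.
have /matrixP/(_ 0 0) := SS; rewrite [in RHS]mxE eqxx => SS0; rewrite -[RHS]SS0.
by rewrite !mxE; apply: eq_bigr => l _; rewrite !mxE.
Qed.

(** Both vectors are the same nonnegative multiple of the first rows of unitaries [S] and [T], and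
    [S ^t* *m T] carries one row to the other. *)
Lemma unitary_transitive (C : numClosedFieldType) (n : nat) (u v : 'rV[C]_n) :
  u *m u ^t* = v *m v ^t* ->
  exists2 U : 'M[C]_n, U *m U ^t* = 1%:M & v = u *m U.
Proof.
case: n u v => [|n] u v uv.
  exists 1%:M; last by apply/rowP => -[].
  by rewrite trmx1 map_mx1 mulmx1.
have [S [b [SS b0 uE]]] := unitary_row_polar u.
have [T [c [TT c0 vE]]] := unitary_row_polar v.
have n1 (M : 'M[C]_n.+1) : M *m M ^t* = 1%:M ->
   row 0 M *m (row 0 M) ^t* = 1%:M.
  move=> /matrixP/(_ 0 0); rewrite mxE [in RHS]mxE eqxx => E.
  apply/matrixP => i j; rewrite !ord1 [in RHS]mxE eqxx -[RHS]E mxE.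
  by apply: eq_bigr => l _; rewrite !mxE.
have nE (M : 'M[C]_n.+1) e : 0 <= e -> M *m M ^t* = 1%:M ->
   ((e *: row 0 M) *m (e *: row 0 M) ^t*) 0 0 = e ^+ 2.
  move=> e0 MM; rewrite linearZ map_mxZ -scalemxAl -scalemxAr n1 // !mxE eqxx mulr1.
  by rewrite expr2; congr (_ * _); exact: geC0_conj.
have bc : b = c.
  apply/eqP; rewrite -(eqrXn2 (ltn0Sn 1) b0 c0).
  by rewrite -(nE S) // -(nE T) // -uE -vE uv.
exists (S ^t* *m T).
  rewrite trmxC_mul trmxCK mulmxA -(mulmxA _ T) TT mulmx1.
  exact: mulmx1C.
by rewrite uE vE bc -!scalemxAl mulmxA -row_mul SS row1 rowE.
Qed.

(** The overlaps of [phi] with an orthonormal basis of the range form a vector of squared norm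
    [<phi|P|phi>]. Unitaries act transitively on vectors of given norm, so a rotation of the basis
    produces the overlaps [c]. *)
Lemma prescribed_overlaps (R : realType) (d n : nat) (P : 'M[R[i]]_d)
    (phi : 'cV[R[i]]_d) (c : 'I_n -> R[i]) :
  orthogonal_projector P -> \rank P = n ->
  \sum_i `|c i| ^+ 2 = braket phi (P *m phi) ->
  exists2 psi : 'I_n -> 'cV[R[i]]_d,
    projector_decomposition P psi & forall i, braket (psi i) phi = c i.
Proof.
move=> projP rkP sumc; have [W WW WP] := projector_row_basis projP rkP.
pose u := phi^T *m W ^t*; pose v : 'rV[R[i]]_n := \row_i c i.
have uv : u *m u ^t* = v *m v ^t*.
  apply/matrixP => a b; rewrite !ord1 {a b}.
  transitivity (braket phi (P *m phi)); last first.
    by rewrite -sumc mxE; apply: eq_bigr => i _; rewrite !mxE sqr_normc.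
  rewrite /u trmxC_mul trmxCK -mulmxA (mulmxA _ W) WP /braket.
  transitivity ((phi ^t* *m (P *m phi))^T 0 0); last by rewrite mxE.
  congr (fun_of_matrix _ 0 0); rewrite !trmx_mul -mulmxA; congr (_ *m (_ *m _)).
  by apply/matrixP => i j; rewrite !mxE.
have [U UU vE] := unitary_transitive uv.
have UU' : U ^t* *m U = 1%:M by exact: mulmx1C.
exists (fun i => (row i (U ^t* *m W))^T).
  apply: projector_decomposition_rows; rewrite trmxC_mul trmxCK.
    by rewrite mulmxA -(mulmxA _ W) WW mulmx1.
  by rewrite mulmxA -(mulmxA _ U) UU mulmx1.
move=> i; have -> : c i = v 0 i by rewrite mxE.
rewrite vE /u -mulmxA -[U in RHS]trmxCK -trmxC_mul /braket !mxE.
by apply: eq_bigr => l _; rewrite !mxE mulrC.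
Qed.

(* Below [r/d] the overlap is shared equally between the basis vectors; above [1/2]
   it is carried by a single one. *)
Lemma contextual_overlap_bounds (R : realType) (d r : nat) (P : 'M[R[i]]_d)
    (phi : 'cV[R[i]]_d) (x : R) :
  orthogonal_projector P -> \rank P = r -> (0 < r < d)%N ->
  braket phi (P *m phi) = x%:C -> 0 <= x ->
  inherited_valuation phi P = LabelC ->
  r%:R / d%:R <= x <= 2^-1.
Proof.
move=> projP rkP /andP[r0 rd] xE x0; subst r.
have d0 : 0 < d%:R :> R by rewrite ltr0n (leq_ltn_trans _ rd).
have dC : d%:R^-1 = (d%:R^-1 : R)%:C by rewrite fmorphV rmorph_nat.
have hC : 2^-1 = (2^-1 : R)%:C by rewrite fmorphV rmorph_nat.
have normC (y : R) : `|(Num.sqrt y)%:C| ^+ 2 = (Num.sqrt y ^+ 2)%:C.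
  by rewrite sqr_normc conjc_real -expr2 rmorphXn.
rewrite /inherited_valuation; case: pselect => // no0; case: pselect => // no1 _.
apply/andP; split; rewrite leNgt; apply/negP => xlt.
- apply: no0; pose r : R := (\rank P)%:R.
  have r_gt0 : 0 < r by rewrite ltr0n.
  have xr0 : 0 <= x / r by rewrite divr_ge0 // ltW.
  have [|psi dec psiE] := @prescribed_overlaps _ _ _ P phi
      (fun=> (Num.sqrt (x / r))%:C) projP erefl.
    rewrite xE sumr_const card_ord normC sqr_sqrtr //.
    by rewrite -rmorphMn /= -mulr_natr divfK ?gt_eqF.
  exists psi; split=> // i; rewrite /annulus_valuation psiE normC.
  rewrite sqr_sqrtr // dC hC lecR ltcR.
  have xd : x / r < d%:R^-1 by rewrite ltr_pdivrMr // mulrC.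
  (* From [0 < r < d] comes [d >= 2], so an overlap below [1/d] is not above [1/2] and the first
     test of the valuation fails. *)
  rewrite ltNge (ltW (lt_le_trans xd _)) /=; last first.
    by rewrite lef_pV2 ?posrE // (ler_nat _ 2) (leq_trans _ rd).
  by rewrite leNgt xd.
- apply: no1; pose k0 : 'I_(\rank P) := Ordinal r0.
  have [|psi dec psiE] := @prescribed_overlaps _ _ _ P phi
      (fun k => if k == k0 then (Num.sqrt x)%:C else 0) projP erefl.
    rewrite (bigD1 k0) //= big1 => [|k /negbTE->]; last first.
      by rewrite normr0 expr0n.
    by rewrite addr0 normC sqr_sqrtr.
  exists psi; split=> // k; rewrite /annulus_valuation psiE.
  case: eqP => _; [right | left].
    by rewrite normC sqr_sqrtr // hC ltcR xlt.
  rewrite normr0 expr0n /= lt_gtF ?invr_gt0 ?ltr0n //.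
  by rewrite lt_geF // invr_gt0 ltr0n -(ltr0n R).
Qed.

(** * Complex matrices as real matrices *)

Lemma Re_sum (R : rcfType) (I : Type) (s : seq I) (F : I -> R[i]) :
  complex.Re (\sum_(j <- s) F j) = \sum_(j <- s) complex.Re (F j).
Proof. by apply: big_morph => // -[a b] [a' b']. Qed.

Lemma Im_sum (R : rcfType) (I : Type) (s : seq I) (F : I -> R[i]) :
  complex.Im (\sum_(j <- s) F j) = \sum_(j <- s) complex.Im (F j).
Proof. by apply: big_morph => // -[a b] [a' b']. Qed.

(** The realification of [M], acting on pairs of real and imaginary parts. It turns Hermitian forms
    on C^n into real quadratic forms on R^(2n), where the quadrature applies. *)
Definition real_mx (R : rcfType) (m n : nat) (M : 'M[R[i]]_(m, n)) :
    'M[R]_(m + m, n + n) :=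
  let A := map_mx (@complex.Re R) M in let B := map_mx (@complex.Im R) M in
  block_mx A (- B) B A.

Definition real_col (R : rcfType) (n : nat) (z : 'cV[R[i]]_n) : 'cV[R]_(n + n) :=
  col_mx (map_mx (@complex.Re R) z) (map_mx (@complex.Im R) z).

Lemma Re_mulmx (R : rcfType) (m n p : nat) (M : 'M[R[i]]_(m, n))
    (N : 'M[R[i]]_(n, p)) :
  map_mx (@complex.Re R) (M *m N) =
  map_mx (@complex.Re R) M *m map_mx (@complex.Re R) N
    - map_mx (@complex.Im R) M *m map_mx (@complex.Im R) N.
Proof.
apply/matrixP => i j; rewrite !mxE Re_sum -sumrB; apply: eq_bigr => k _.
by rewrite !mxE; case: (M i k) (N k j) => [a b] [a' b'].
Qed.

Lemma Im_mulmx (R : rcfType) (m n p : nat) (M : 'M[R[i]]_(m, n))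
    (N : 'M[R[i]]_(n, p)) :
  map_mx (@complex.Im R) (M *m N) =
  map_mx (@complex.Im R) M *m map_mx (@complex.Re R) N
    + map_mx (@complex.Re R) M *m map_mx (@complex.Im R) N.
Proof.
apply/matrixP => i j; rewrite !mxE Im_sum -big_split; apply: eq_bigr => k _.
by rewrite !mxE /=; case: (M i k) (N k j) => [a b] [a' b'] /=; rewrite addrC.
Qed.

Lemma real_mxM (R : rcfType) (m n p : nat) (M : 'M[R[i]]_(m, n))
    (N : 'M[R[i]]_(n, p)) : real_mx (M *m N) = real_mx M *m real_mx N.
Proof.
rewrite /real_mx mulmx_block Re_mulmx Im_mulmx !mulNmx !mulmxN opprD.
by congr block_mx; rewrite addrC.
Qed.

Lemma real_mx_col (R : rcfType) (m n : nat) (M : 'M[R[i]]_(m, n))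
    (z : 'cV[R[i]]_n) : real_mx M *m real_col z = real_col (M *m z).
Proof. by rewrite /real_mx /real_col mul_block_col Re_mulmx Im_mulmx mulNmx. Qed.

Lemma real_mx_adjoint (R : rcfType) (m n : nat) (M : 'M[R[i]]_(m, n)) :
  real_mx (M ^t*) = (real_mx M)^T.
Proof.
rewrite /real_mx tr_block_mx; congr block_mx; apply/matrixP => i j; rewrite !mxE.
- by case: (M j i).
- by case: (M j i) => a b /=; rewrite opprK.
- by case: (M j i).
- by case: (M j i).
Qed.

Lemma mxtrace_real_mx (R : rcfType) (n : nat) (M : 'M[R[i]]_n) :
  \tr (real_mx M) = 2 * complex.Re (\tr M).
Proof.
rewrite /real_mx mxtrace_block -mulr2n mulr_natl; congr (_ *+ 2).
by rewrite /mxtrace Re_sum; apply: eq_bigr => i _; rewrite mxE.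
Qed.

Lemma real_mx1 (R : rcfType) (n : nat) : real_mx (1%:M : 'M[R[i]]_n) = 1%:M.
Proof.
rewrite scalar_mx_block /real_mx; congr block_mx; apply/matrixP => i j;
  by rewrite !mxE; case: eqP => //= _; rewrite oppr0.
Qed.

Lemma real_col_surj (R : rcfType) (n : nat) (v : 'cV[R]_(n + n)) :
  exists z : 'cV[R[i]]_n, v = real_col z.
Proof.
exists (\col_i (usubmx v i 0 +i* dsubmx v i 0)); rewrite -[LHS]vsubmxK.
by congr col_mx; apply/colP => i; rewrite !mxE.
Qed.

Lemma qform_real_mx (R : realType) (n : nat) (M : 'M[R[i]]_n)
    (z : 'cV[R[i]]_n) :
  qform (real_mx M) (real_col z) = complex.Re (braket z (M *m z)).
Proof.
rewrite /qform -mulmxA real_mx_col mxE /braket [in RHS]mxE Re_sum.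
rewrite big_split_ord /= -big_split; apply: eq_bigr => j _ /=.
move: (M *m z) => w; rewrite ![(real_col z)^T _ _]mxE !col_mxEu !col_mxEd !mxE /=.
by case: (z j 0) (w j 0) => [a b] [a' b'] /=; rewrite mulNr opprK.
Qed.

(** In a full-rank factorisation of [P], idempotence forces the product of the factors in reverse
    order to be the identity of size [\rank P], and the trace is cyclic. *)
Lemma mxtrace_idempotent (F : fieldType) (n : nat) (P : 'M[F]_n) :
  P *m P = P -> \tr P = (\rank P)%:R.
Proof.
move=> PP; rewrite -{1}(mulmx_base P) mxtrace_mulC.
suff -> : row_base P *m col_base P = 1%:M by rewrite mxtrace1.
apply: (row_free_inj (row_base_free P)).
apply: (row_full_inj (col_base_full P)).
rewrite mul1mx mulmx_base -[row_base P *m _ *m _]mulmxA.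
by rewrite mulmx_base mulmxA mulmx_base PP.
Qed.

(** * Averaging over unit vectors *)

Lemma braket_self (R : realType) (n : nat) (z : 'cV[R[i]]_n) :
  braket z z = \sum_j `|z j 0| ^+ 2.
Proof.
by rewrite /braket mxE; apply: eq_bigr => j _; rewrite sqr_normc !mxE mulrC.
Qed.

Lemma braket_self_ge0 (R : realType) (n : nat) (z : 'cV[R[i]]_n) :
  0 <= braket z z.
Proof. by rewrite braket_self sumr_ge0 // => j _; rewrite exprn_ge0. Qed.

Lemma braket_projector_ge0 (R : realType) (n : nat) (P : 'M[R[i]]_n)
    (z : 'cV[R[i]]_n) :
  orthogonal_projector P -> 0 <= braket z (P *m z).
Proof.
move=> [PP Ph]; suff -> : braket z (P *m z) = braket (P *m z) (P *m z).
  exact: braket_self_ge0.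
by rewrite /braket trmxC_mul Ph !mulmxA -(mulmxA _ P P) PP.
Qed.

Lemma braket_scale (R : realType) (n : nat) (a : R) (z w : 'cV[R[i]]_n) :
  braket (a%:C *: z) (a%:C *: w) = (a ^+ 2)%:C * braket z w.
Proof.
rewrite /braket; have -> : (a%:C *: z) ^t* = a%:C *: z ^t*.
  apply/matrixP => k l; rewrite !mxE rmorphM; congr (_ * _); exact: conjc_real.
by rewrite -scalemxAl -scalemxAr scalerA mxE rmorphXn.
Qed.

Lemma real_mx_projector (R : realType) (d : nat) (P : 'M[R[i]]_d) :
  orthogonal_projector P ->
  [/\ (real_mx P)^T = real_mx P, real_mx P *m real_mx P = real_mx P
    & \tr (real_mx P) = (2 * \rank P)%:R].
Proof.
move=> [PP Ph]; split.
- by rewrite -real_mx_adjoint Ph.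
- by rewrite -real_mxM PP.
- by rewrite mxtrace_real_mx mxtrace_idempotent // natrM -(rmorph_nat (real_complex R)).
Qed.

Lemma beta_poly_ge0 (R : realDomainType) (r s : nat) (x : R) :
  0 <= x <= 1 -> 0 <= (beta_poly R r s).[x].
Proof.
move=> /andP[x0 x1]; rewrite hornerM !horner_exp !hornerE.
by rewrite mulr_ge0 // exprn_ge0 // subr_ge0.
Qed.

(** The pointwise bound at [v / |v|], multiplied by [nv v ^+ K], becomes polynomial in [v] and can
    be averaged by the quadrature. The moments of the quadratic forms are proportional to those of
    Beta(r, d - r), with the common factor [Z / B]. *)
Lemma overlap_average_le (R : realType) (d r : nat) (s : seq 'M[R[i]]_d)
    (h : {poly R}) (c : R) :
  (0 < r < d)%N ->
  (forall P, P \in s -> orthogonal_projector P /\ \rank P = r) ->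
  (forall phi, unit_vector phi ->
     c <= \sum_(P <- s) h.[complex.Re (braket phi (P *m phi))]) ->
  c * poly_int 0 1 (beta_poly R r (d - r)) <=
    (size s)%:R * poly_int 0 1 (h * beta_poly R r (d - r)).
Proof.
move=> /andP[r0 rd] projs lec; set B := poly_int 0 1 _.
(* [K] exceeds every exponent [k] of [h], so both sides of the homogenised bound vanish at [v = 0].
   The forms are quadratic, whence the order [2 * K] below. *)
pose K := (size h).+1.
have [m [w [x [w0 w1 wx]]]] := hermite_quadrature R (2 * K).
pose nv (v : 'cV[R]_(d + d)) := qform 1%:M v.
pose E (F : 'cV[R]_(d + d) -> R) := nodes_avg w x F.
pose Z := E (fun v => nv v ^+ K).
have pointwise v : c * nv v ^+ K <= \sum_(P <- s) \sum_(k < size h)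
    h`_k * (qform (real_mx P) v ^+ k * nv v ^+ (K - k)).
  have [z vE] := real_col_surj v.
  have nvE : (nv v)%:C = braket z z.
    rewrite /nv vE -real_mx1 qform_real_mx mul1mx; apply: RRe_real.
    exact/ger0_real/braket_self_ge0.
  have nv0 : 0 <= nv v by rewrite -ler0c nvE braket_self_ge0.
  move: nv0; rewrite le_eqVlt => /predU1P[<-|nv_gt0].
    rewrite expr0n mulr0 big_seq sumr_ge0 // => P _; apply: sumr_ge0 => k _.
    by rewrite expr0n subn_eq0 leqNgt ltnS (ltnW (ltn_ord k)) !mulr0.
  pose a := (Num.sqrt (nv v))^-1.
  have a2 : a ^+ 2 = (nv v)^-1 by rewrite exprVn sqr_sqrtr // ltW.
  have uphi : unit_vector (a%:C *: z).
    by rewrite /unit_vector braket_scale a2 -nvE -rmorphM mulVf ?gt_eqF.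
  have := lec _ uphi; rewrite -(ler_pM2r (exprn_gt0 K nv_gt0)) => /le_trans; apply.
  rewrite big_distrl /=; apply: ler_sum => P _; rewrite -scalemxAr braket_scale a2.
  have -> : complex.Re ((nv v)^-1%:C * braket z (P *m z)) =
      (nv v)^-1 * qform (real_mx P) v.
    by rewrite vE qform_real_mx; case: (braket _ _) => ? ? /=; rewrite mul0r subr0.
  rewrite horner_coef big_distrl /=; apply: ler_sum => k _.
  have nvK : nv v ^+ K = nv v ^+ k * nv v ^+ (K - k).
    by rewrite -exprD subnKC // leqW // ltnW.
  have nvk : nv v ^+ k != 0 by rewrite expf_eq0 (gt_eqF nv_gt0) andbF.
  by rewrite nvK exprMn exprVn le_eqVlt; apply/orP; left; apply/eqP; field.
have rd_gt0 : (0 < d - r)%N by rewrite subn_gt0.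
have momE P k : P \in s -> (k < size h)%N ->
    E (fun v => qform (real_mx P) v ^+ k * nv v ^+ (K - k)) * B =
    poly_int 0 1 ('X^k * beta_poly R r (d - r)) * Z.
  move=> /projs [projP rkP] ltk.
  have [symQ idQ trQ] := real_mx_projector projP.
  have kK : (k + (K - k) = K)%N by rewrite subnKC // leqW // ltnW.
  have [||EE _] := @nodes_avg_qform_moment _ _ _ _ k (K - k)%N w x _ _ _ w1 wx symQ idQ.
  - by rewrite addn_gt0 (leq_ltn_trans (leq0n r) rd).
  - by rewrite kK.
  rewrite kK in EE; rewrite /E EE poly_int_beta_moment // -/B.
  rewrite mulrAC; congr (_ * _ * _); apply: eq_bigr => j _.
  (* Realification doubles both the trace and the dimension, so the factors 2 cancel and
     [(r + j) / (d + j)] remains. *)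
  rewrite trQ rkP subnKC ?(ltnW rd) // -natrD addnn -mul2n -!mulnDr !natrM.
  by rewrite -mulf_div divff ?mul1r // pnatr_eq0.
have d2_gt0 : (0 < d + d)%N by rewrite addn_gt0 (leq_ltn_trans (leq0n r) rd).
have Z0 : 0 < Z.
  have le2K : (2 * (0 + K) <= 2 * K)%N by [].
  by have [] := nodes_avg_qform_moment d2_gt0 le2K w1 wx (trmx1 _ _) (mul1mx _).
have ineq : c * Z <= \sum_(P <- s) \sum_(k < size h)
    h`_k * E (fun v => qform (real_mx P) v ^+ k * nv v ^+ (K - k)).
  rewrite -[c * Z](nodes_avgZ w x c (fun v => nv v ^+ K)).
  have := @le_nodes_avg _ _ _ w x _ _ w0 pointwise.
  rewrite nodes_avg_sum => /le_trans; apply.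
  apply: ler_sum => P _; rewrite nodes_avg_sum; apply: ler_sum => k _.
  by rewrite nodes_avgZ.
have B0 : 0 <= B by rewrite poly_int_ge0 // => y; exact: beta_poly_ge0.
rewrite -(ler_pM2r Z0) mulrAC; apply: (le_trans (ler_wpM2r B0 ineq)).
rewrite big_distrl big_seq /=.
rewrite (eq_bigr (fun=> poly_int 0 1 (h * beta_poly R r (d - r)) * Z)).
  by rewrite -big_seq big_const_seq count_predT iter_addr_0 -mulrA mulr_natl.
move=> P Ps; have hE : h = \sum_(k < size h) h`_k *: 'X^k.
  by rewrite -[LHS]coefK poly_def.
rewrite big_distrl /= [X in poly_int 0 1 (X * _)]hE big_distrl poly_int_sum.
rewrite big_distrl.
apply: eq_bigr => k _ /=; rewrite -mulrA (momE P k Ps) //.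
by rewrite -scalerAl poly_intZ mulrA.
Qed.

(** On [[1/4, 1/2]] one has [x >= 1/4] and [1 - x >= 1/2], so the density is at least [k] there;
    elsewhere on [[0, 1]] it is nonnegative. *)
Lemma poly_int_beta_gt0 (R : realType) (r s : nat) :
  0 < poly_int 0 1 (beta_poly R r s).
Proof.
set b := beta_poly R r s; pose k : R := 4^-1 ^+ r.-1 * 2^-1 ^+ s.-1.
have k0 : 0 < k by rewrite mulr_gt0 // exprn_gt0.
have ge0 (x y : R) : 0 <= x -> x <= y -> y <= 1 -> 0 <= poly_int x y b.
  move=> x0 xy y1; rewrite poly_int_ge0 // => t /andP[xt ty].
  by rewrite beta_poly_ge0 // (le_trans x0) //= (le_trans ty).
rewrite (poly_int_chasles 0 4^-1) (poly_int_chasles 4^-1 2^-1 1).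
have I1 : 0 <= poly_int 0 4^-1 b by apply: ge0; lra.
have I3 : 0 <= poly_int 2^-1 1 b by apply: ge0; lra.
have I2 : poly_int 4^-1 2^-1 k%:P <= poly_int 4^-1 2^-1 b.
  apply: le_poly_int => [|t /andP[t4 t2]]; first by lra.
  rewrite hornerC hornerM !horner_exp !hornerE ler_pM ?exprn_ge0 ?lerXn2r ?nnegrE //; lra.
have I4 : poly_int 4^-1 2^-1 k%:P = k * (2^-1 - 4^-1).
  have -> : k%:P = (k *: 'X)^`() by rewrite derivZ derivX alg_polyC.
  by rewrite poly_int_deriv !hornerE mulrBr.
have : 0 < k * (2^-1 - 4^-1) by rewrite mulr_gt0 //; lra.
lra.
Qed.

Lemma braket_projector_le (R : realType) (n : nat) (P : 'M[R[i]]_n)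
    (z : 'cV[R[i]]_n) :
  orthogonal_projector P -> braket z (P *m z) <= braket z z.
Proof.
move=> [PP Ph]; rewrite -subr_ge0.
have -> : braket z z - braket z (P *m z) = braket z ((1%:M - P) *m z).
  by rewrite /braket mulmxBl mul1mx mulmxBr [in RHS]mxE [in X in _ = _ + X]mxE.
apply: braket_projector_ge0; split.
  by rewrite mulmxBr mulmxBl mul1mx mulmx1 mulmxBl mul1mx PP subrr subr0.
by rewrite linearB /= trmx1 map_mxB map_mx1 Ph.
Qed.

(** * Counting contextual projectors *)

Lemma card_fset_sep (T : choiceType) (A : {fset T}) (p : pred T) :
  #|` [fset y in A | p y]%fset| = count p A.
Proof.
rewrite -size_filter; apply: perm_size; apply: uniq_perm.
- exact: fset_uniq.
- by rewrite filter_uniq // fset_uniq.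
- by move=> y; rewrite mem_filter !inE andbC.
Qed.

Theorem theorem3 (R : realType) (d r : nat) (Ps : {fset 'M[R[i]]_d})
    (d_gt0 : (0 < d)%N) (r_gt0 : (0 < r)%N) (r_dvd_d : (r %| d)%N)
    (r_lt_d : (r < d)%N)
    (Ps_proj : forall P, P \in Ps -> orthogonal_projector P /\ \rank P = r) :
  exists phi : 'cV[R[i]]_d,
    unit_vector phi /\
    (#|` [fset P in Ps | `[< inherited_valuation phi P = LabelC >] ]%fset |)%:R
      <= (reg_incomplete_beta (2^-1 : R) r%:R (d%:R - r%:R)
          - reg_incomplete_beta (r%:R / d%:R) r%:R (d%:R - r%:R))
         * (#|` Ps |)%:R.
Proof.
set b := beta_poly R r (d - r); set B := poly_int 0 1 b.
have B0 : 0 < B by exact: poly_int_beta_gt0.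
pose a : R := r%:R / d%:R; pose J := poly_int a 2^-1 b.
have d0 : 0 < d%:R :> R by rewrite ltr0n.
have a0 : 0 < a by rewrite divr_gt0 // ltr0n.
(* A proper divisor [r] of [d] satisfies [2 r <= d]. *)
have a2 : a <= 2^-1.
  have /dvdnP [k dE] := r_dvd_d.
  rewrite /a ler_pdivrMr // mulrC ler_pdivlMr // -natrM ler_nat.
  move: r_lt_d; rewrite dE; case: k {dE} => [|[|k]]; rewrite ?mul0n ?mul1n ?ltnn //.
  by move=> _; rewrite mulnC leq_mul2r !ltnS orbT.
have -> : reg_incomplete_beta (2^-1 : R) r%:R (d%:R - r%:R)
    - reg_incomplete_beta a r%:R (d%:R - r%:R) = J / B.
  rewrite /reg_incomplete_beta !incomplete_betaE ?ltr01 ?lexx //; first last.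
  - by apply/andP; split; lra.
  - by apply/andP; split; lra.
  - by rewrite -mulrBl /J /poly_int; congr (_ / _); ring.
have J0 : 0 <= J.
  rewrite poly_int_ge0 // => x /andP[ax x2]; rewrite beta_poly_ge0 //.
  by apply/andP; split; lra.
set N : R := (#|` Ps |)%:R; have N0 : 0 <= N by exact: ler0n.
(* [m] is the least integer above the claimed bound. If no [phi] works, every count is an integer
   above that bound, hence at least [m]: the gap is uniform in [phi]. *)
apply: contrapT => noPhi; pose m := (Num.truncn (J / B * N)).+1.
have JBN0 : 0 <= J / B * N by rewrite mulr_ge0 // divr_ge0 // ltW.
have mlt : J / B * N < m%:R by case/andP: (truncn_itv JBN0).
have count_ge phi : unit_vector phi ->
    m%:R <= (count (fun P => `[< inherited_valuation phi P = LabelC >]) Ps)%:R :> R.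
  move=> uphi; rewrite ler_nat /m -(ltr_nat R).
  have /andP[tle _] := truncn_itv JBN0; apply: le_lt_trans tle _.
  rewrite ltNge; apply/negP => le_count; apply: noPhi; exists phi; split=> //.
  by rewrite card_fset_sep.
(* This choice gives [e * (N + 1) = m%:R * B - J * N], so [N * (J + e)] falls short of [m%:R * B] by
   exactly [e], contradicting [le1] and [le2]. *)
pose e := (m%:R - J / B * N) * B / (N + 1).
have N1 : 0 < N + 1 by lra.
have e0 : 0 < e by rewrite divr_gt0 // mulr_gt0 // subr_gt0.
have [||h [h1 h0 hb]] := @exists_poly_majorant R a 2^-1 e b a0 a2 _ e0.
- lra.
- by move=> x; exact: beta_poly_ge0.
have rd : (0 < r < d)%N by rewrite r_gt0.
have le1 : m%:R * B <= N * poly_int 0 1 (h * b).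
  apply: (overlap_average_le rd Ps_proj) => phi uphi.
  apply: le_trans (count_ge phi uphi) _.
  rewrite -sum1_count natr_sum big_mkcond /= big_seq [X in _ <= X]big_seq.
  apply: ler_sum => P /Ps_proj [projP rkP].
  have x0 := braket_projector_ge0 phi projP.
  pose x := complex.Re (braket phi (P *m phi)).
  have xE : braket phi (P *m phi) = x%:C by apply/esym/RRe_real/ger0_real.
  have x0R : 0 <= x by rewrite -ler0c -xE.
  have x1 : x <= 1.
    by rewrite -lecR -xE -[X in _ <= X]uphi braket_projector_le.
  (* A contextual projector has its overlap in [[a, 1/2]], where [h] is at least 1; any other
     contributes 0 to the count, while [h] is nonnegative on [[0, 1]]. *)
  rewrite -/x; case: asboolP => [cP|_]; last by rewrite h0 // x0R.
  by apply: h1; exact: contextual_overlap_bounds projP rkP rd xE x0R cP.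
have le2 : N * poly_int 0 1 (h * b) <= N * (J + e) by rewrite ler_wpM2l.
have e1 : e * (N + 1) = (m%:R - J / B * N) * B by rewrite divfK // gt_eqF.
have e2 : (m%:R - J / B * N) * B = m%:R * B - J * N.
  by field; rewrite gt_eqF.
nra.
Qed.
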